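(* Fix a prime power $q$ and constants $L>0$ and $B>(q-1)^{-2/3}+L$. For all sufficiently large $m$, suppose that $r,j$ are positive integers satisfying \[ |r-r_m|\le L r_m^{1/3},\qquad \eta_m(r-r_m)\le j\le B r_m^{1/3}, \] and that $s=(1-1/q)(r-j)$ is a positive integer. Then, uniformly over the stated parameters, \[ A_q(r,s)=\Theta_{q,L,B}(r^{4/3})\qquad\text{and}\qquad R(q+1;r,s)=\Theta_{q,L,B}(r^{4/3}). \]
   Context: For a prime power $q$ and a positive integer $m$, write $Q=q^m$, \[ r_m=\frac{(Q^2+1)(Q-1)}{q-1},\qquad j_m=\frac{Q-1}{q-1}, \] and, for an integer $t$, \[ \eta_m(t)=\begin{cases} j_m+t, & t\ge 0,\\ j_m-t/(q-1), & t<0.\end{cases} \] For positive integers $k,r,s$ with $r>s$, the set-coloring Ramsey number $R(k;r,s)$ is the least $N$ such that every assignment of an $s$-element subset of $[r]=\{1,\dots,r\}$ to each edge of the complete graph $K_N$ yields a copy of $K_k$ whose edges share a common color (i.e. some $c\in[r]$ belongs to the sets assigned to all edges of that copy). A $q$-ary code of length $r$ is a subset of $[q]^r$; its minimum Hamming distance is the least number of coordinates in which two distinct codewords differ. $A_q(r,d)$ denotes the maximum size of a $q$-ary code of length $r$ with minimum Hamming distance at least $d$. The notation $\Theta_{q,L,B}$, uniformly over the stated parameters, means that the implied positive constants (and the threshold for $m$ being sufficiently large) depend only on $q,L,B$, and not on $m,r,j$. *)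

(* Defs.v *)
From mathcomp Require Import all_boot all_order all_algebra.
From mathcomp Require Import all_classical all_reals all_analysis.
Set Implicit Arguments.
Unset Strict Implicit.
Unset Printing Implicit Defensive.
Import Order.TTheory GRing.Theory Num.Theory.
Local Open Scope ring_scope.

Definition prime_power (q : nat) : Prop :=
  exists p e : nat, [/\ prime p, (0 < e)%N & q = (p ^ e)%N].

(* Both divisions below are exact, since q - 1 divides q ^ m - 1. *)
Definition r_of (q m : nat) : nat :=
  (((q ^ m) ^ 2 + 1) * (q ^ m - 1)) %/ (q - 1).

Definition j_of (q m : nat) : nat := (q ^ m - 1) %/ (q - 1).

Definition eta (R : realType) (q m : nat) (t : int) : R :=
  if 0 <= t then (j_of q m)%:R + t%:~R
  else (j_of q m)%:R - t%:~R / (q%:R - 1).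

Definition hamming_dist (q r : nat) (x y : {ffun 'I_r -> 'I_q}) : nat :=
  #|[set i | x i != y i]|.

(* Vacuously true of codes with at most one word, whose minimum distance is
   the minimum of an empty set. *)
Definition min_dist_ge (q r : nat) (C : {set {ffun 'I_r -> 'I_q}}) (d : nat)
  : bool :=
  [forall x in C, forall y in C, (x != y) ==> (d <= hamming_dist x y)%N].

Definition max_code_size (q r d : nat) : nat :=
  \max_(C : {set {ffun 'I_r -> 'I_q}} | min_dist_ge C d) #|C|.

(* The edges of K_N are the 2-element sets of vertices; the values of the
   coloring f on other sets are irrelevant. *)
Definition set_coloring (N r s : nat) (f : {set 'I_N} -> {set 'I_r}) : Prop :=
  forall e : {set 'I_N}, #|e| = 2%N -> #|f e| = s.

Definition has_mono_clique (k N r : nat) (f : {set 'I_N} -> {set 'I_r})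
  : Prop :=
  exists (S : {set 'I_N}) (c : 'I_r),
    #|S| = k /\
    forall e : {set 'I_N}, #|e| = 2%N -> e \subset S -> c \in f e.

Definition set_ramsey_prop (k r s N : nat) : Prop :=
  forall f : {set 'I_N} -> {set 'I_r},
    set_coloring s f -> has_mono_clique k f.

(* R(k; r, s) = N. This is a relation because the least N need not exist when
   s = 0. *)
Definition is_set_ramsey (k r s N : nat) : Prop :=
  set_ramsey_prop k r s N /\
  forall N' : nat, set_ramsey_prop k r s N' -> (N <= N')%N.

(* Main.v *)
Require Import Defs.
From mathcomp Require Import all_boot all_order all_algebra.
From mathcomp Require Import all_classical all_reals all_analysis.
From mathcomp Require Import finfield ring lra zify.
From mathcomp Require Import fintype finset.
Import Order.TTheory GRing.Theory Num.Theory.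
Local Open Scope ring_scope.

(** Write Q = q ^ m and rho for the length [r_of q m], so that rho has order
    Q ^ 3 and r ^ (4/3) has order Q ^ 4. The theorem follows from a chain

      c r ^ (4/3) <= Q ^ 4 <= A_q(r,s) < R(q+1;r,s) <= C r ^ (4/3).

    Lower bound on codes. Take the elliptic quadric in projective 3-space over
    the field with Q elements: Q ^ 2 + 1 points, of which a plane contains at
    most Q + 1. Evaluating linear forms on it gives Q ^ 4 words of length
    Q ^ 2 + 1 over Q letters, any two of them agreeing at most Q + 1 times
    ([ovoid_code]). Replacing each letter by a word of a q-ary simplex code of
    length (Q - 1)/(q - 1), in which all distances are Q / q ([simplex_code]),
    gives Q ^ 4 words of length rho and distance Q ^ 2 (Q - 1) / q. Padding with
    a constant, or puncturing, changes the length to r, and the lower bound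
    [eta] on j ensures that the distance is still at least s.

    Codes give colourings. Colour a pair of words by s of the positions where
    they differ. On a clique of colour c the c-th letters are pairwise
    different, so that the clique has at most q vertices ([code_refutes_ramsey]).

    Upper bound on the Ramsey number. Suppose that K_N is coloured without a
    monochromatic K_{q+1}. Every colour class is a K_{q+1}-free graph, and
    because each edge has s = (1 - 1/q)(r - j) colours, the classes fall short
    of the Turan bound (1 - 1/q) N ^ 2 / 2 by only O(j N ^ 2) edges in total,
    if N >= r. A K_{q+1}-free graph which is d edges short of that bound
    becomes q-partite after the deletion of O(d / N) vertices
    ([turan_stability]). Hence an average vertex is deleted in O(j) colours,
    and half of the vertices are deleted in O(j) colours each. Reading off,
    for those vertices, the part in which they lie in each colour yields N / 2
    words of length r over q letters with distance at least (1 - 1/q) r -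
    O(j). Such a code has O(r j) words as long as j is O(r ^ (1/2))
    ([code_size_bound]), and here j = O(r ^ (1/3)).

    The bound on codes is a bound on vectors in Euclidean space: a letter
    becomes a vertex of a regular simplex, and the inner products of distinct
    words are then O(j), while those of words with themselves have order r. In
    dimension n, let g range over the entries of the Gram matrix of N vectors
    with squared norm D and other inner products at most J. The cubic
    (g - J)(g + b) ^ 2 is nonpositive off the diagonal. On the other hand the
    sums of g and of g ^ 3 over all entries are nonnegative, and the sum of
    g ^ 2 is at least (N D) ^ 2 / n. Summing the cubic over all entries, with b
    suitably chosen, bounds N ([spherical_code_bound]). *)

(** * Families of vectors with small pairwise inner products *)

(** The difference of the two sides is half the sum of all
    [(a p - a p') ^+ 2]. *)
Lemma sumr_sqr_le (R : realFieldType) (P : finType) (a : P -> R) :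
  (\sum_p a p) ^+ 2 <= #|P|%:R * \sum_p a p ^+ 2.
Proof.
have : 0 <= \sum_p \sum_p' (a p - a p') ^+ 2.
  by apply: sumr_ge0 => p _; apply: sumr_ge0 => p' _; exact: sqr_ge0.
have -> : \sum_p \sum_p' (a p - a p') ^+ 2
    = 2 * (#|P|%:R * \sum_p a p ^+ 2) - 2 * (\sum_p a p) ^+ 2.
  transitivity (\sum_p (#|P|%:R * a p ^+ 2 - 2 * (a p * (\sum_p' a p'))
                        + \sum_p' a p' ^+ 2)).
    apply: eq_bigr => p _.
    rewrite mulr_natl -[a p ^+ 2 *+ _]sumr_const !mulr_sumr -sumrB -big_split /=.
    by apply: eq_bigr => p' _; ring.
  rewrite big_split sumrB /= sumr_const -!mulr_sumr -mulr_suml -mulr_natl.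
  by ring.
lra.
Qed.

(** The k-th entrywise power of a Gram matrix is the Gram matrix of the k-fold
    tensor powers, whose coordinates are indexed by the maps from ['I_k] to the
    coordinates; the sum of its entries is a squared norm. *)
Lemma gram_pow_sum_ge0 (R : realFieldType) (V P : finType) (A : {set V})
    (u : V -> P -> R) (k : nat) :
  0 <= \sum_(x in A) \sum_(y in A) (\sum_p u x p * u y p) ^+ k.
Proof.
have -> : \sum_(x in A) \sum_(y in A) (\sum_p u x p * u y p) ^+ k
  = \sum_(f : {ffun 'I_k -> P}) (\sum_(x in A) \prod_i u x (f i)) ^+ 2.
  transitivity (\sum_(x in A) \sum_(y in A) \sum_(f : {ffun 'I_k -> P})
      (\prod_i u x (f i)) * (\prod_i u y (f i))).
    apply: eq_bigr => x _; apply: eq_bigr => y _.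
    rewrite -[k in LHS]card_ord -prodr_const bigA_distr_bigA /=.
    by apply: eq_bigr => f _; rewrite big_split.
  transitivity (\sum_(f : {ffun 'I_k -> P}) \sum_(x in A) \sum_(y in A)
      (\prod_i u x (f i)) * (\prod_i u y (f i))).
    by rewrite [RHS]exchange_big; apply: eq_bigr => x _; rewrite [RHS]exchange_big.
  apply: eq_bigr => f _; rewrite expr2 mulr_suml.
  by apply: eq_bigr => x _; rewrite mulr_sumr.
by apply: sumr_ge0 => f _; exact: sqr_ge0.
Qed.

(** The sum of the squared entries of the Gram matrix is also the sum of the
    squared entries of the second moment matrix of the vectors, which has
    size [#|P|]. Only its diagonal is kept, and Cauchy-Schwarz compares it with
    its trace. *)
Lemma gram_sqr_sum_ge (R : realFieldType) (V P : finType) (A : {set V})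
    (u : V -> P -> R) :
  (\sum_(x in A) \sum_p u x p * u x p) ^+ 2
    <= #|P|%:R * \sum_(x in A) \sum_(y in A) (\sum_p u x p * u y p) ^+ 2.
Proof.
have -> : \sum_(x in A) \sum_(y in A) (\sum_p u x p * u y p) ^+ 2
  = \sum_p \sum_p' (\sum_(x in A) u x p * u x p') ^+ 2.
  transitivity (\sum_(x in A) \sum_(y in A) \sum_p \sum_p'
      (u x p * u x p') * (u y p * u y p')).
    apply: eq_bigr => x _; apply: eq_bigr => y _; rewrite expr2 mulr_suml.
    apply: eq_bigr => p _; rewrite mulr_sumr.
    by apply: eq_bigr => p' _; ring.
  transitivity (\sum_p \sum_p' \sum_(x in A) \sum_(y in A)
      (u x p * u x p') * (u y p * u y p')).
    transitivity (\sum_(x in A) \sum_p \sum_p' \sum_(y in A)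
      (u x p * u x p') * (u y p * u y p')).
      apply: eq_bigr => x _; rewrite exchange_big.
      by apply: eq_bigr => p _; rewrite exchange_big.
    rewrite exchange_big.
    by apply: eq_bigr => p _; rewrite exchange_big.
  apply: eq_bigr => p _; apply: eq_bigr => p' _; rewrite expr2 mulr_suml.
  by apply: eq_bigr => x _; rewrite mulr_sumr.
rewrite exchange_big /=; apply: le_trans (sumr_sqr_le _ _ _) _.
apply: ler_wpM2l => //; apply: ler_sum => p _.
rewrite (bigD1 p) //= lerDl; apply: sumr_ge0 => p' _; exact: sqr_ge0.
Qed.

(** This b balances the two leading terms [2 * b * D ^+ 2 / n] and
    [J * b ^+ 2] in the sum of the cubic [(g - J) * (g + b) ^+ 2]: the second
    one is a quarter of the first. *)
Lemma cubic_test_parameter (R : realFieldType) (n D J : R) :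
    0 < J -> 0 < D -> D <= 2 * n * J -> 4 * n * J ^+ 2 <= D ^+ 2 ->
  exists b, [/\ b * (2 * n * J) = D ^+ 2, 0 < b, 2 * J <= b & b <= D].
Proof.
move=> J0 D0 DJ JD; have nJ0 : 0 < 2 * n * J by exact: lt_le_trans DJ.
have bE : D ^+ 2 / (2 * n * J) * (2 * n * J) = D ^+ 2 by rewrite divfK // gt_eqF.
exists (D ^+ 2 / (2 * n * J)); split => //.
- by rewrite divr_gt0 // exprn_gt0.
- rewrite -(ler_pM2r nJ0) bE; apply: le_trans JD.
  by rewrite le_eqVlt; apply/orP; left; apply/eqP; ring.
- by rewrite -(ler_pM2r nJ0) bE expr2 ler_pM2l.
Qed.

Lemma sum_cubic (R : realFieldType) (V : finType) (A : {set V})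
    (g : V -> V -> R) (J b : R) :
  \sum_(x in A) \sum_(y in A) (g x y - J) * (g x y + b) ^+ 2 =
      \sum_(x in A) \sum_(y in A) g x y ^+ 3
      + (2 * b - J) * \sum_(x in A) \sum_(y in A) g x y ^+ 2
      + (b ^+ 2 - 2 * J * b) * \sum_(x in A) \sum_(y in A) g x y ^+ 1
      - J * b ^+ 2 * #|A|%:R ^+ 2.
Proof.
have -> : #|A|%:R ^+ 2 = \sum_(x in A) \sum_(y in A) (1 : R).
  by rewrite !sumr_const expr2 mulr_natr.
rewrite !mulr_sumr -!big_split -sumrB /=; apply: eq_bigr => x _.
rewrite !mulr_sumr -!big_split -sumrB /=; apply: eq_bigr => y _.
by ring.
Qed.

(** The linear programming bound with the cubic [(g - J) * (g + b) ^+ 2]. Off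
    the diagonal it is nonpositive, so the sum over all pairs is at most
    [#|A|] times its value at D; the positivity of the power sums bounds the
    same sum from below by a multiple of [#|A| ^ 2]. *)
Lemma spherical_code_bound (R : realFieldType) (V P : finType) (A : {set V})
    (u : V -> P -> R) (D J : R) :
    0 < J -> 0 < D ->
    (forall x, x \in A -> \sum_p u x p * u x p = D) ->
    (forall x y, x \in A -> y \in A -> x != y ->
       \sum_p u x p * u y p <= J) ->
    D <= 2 * #|P|%:R * J -> 4 * #|P|%:R * J ^+ 2 <= D ^+ 2 ->
  #|A|%:R * D <= 8 * #|P|%:R ^+ 2 * J.
Proof.
move=> J0 D0 diag off DJ JD.
have [b [bE b0 bJ bD]] := cubic_test_parameter _ _ _ _ J0 D0 DJ JD.
pose g x y := \sum_p u x p * u y p.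
have up : \sum_(x in A) \sum_(y in A) (g x y - J) * (g x y + b) ^+ 2
    <= #|A|%:R * (D * (2 * D) ^+ 2).
  rewrite mulr_natl -sumr_const; apply: ler_sum => x xA.
  rewrite (bigD1 x) //= -[X in _ <= X]addr0; apply: lerD.
    rewrite /g diag //; clear -J0 D0 bJ bD b0; apply: ler_pM.
    - lra.
    - exact: sqr_ge0.
    - lra.
    by apply: lerXn2r; rewrite ?nnegrE; lra.
  apply: sumr_le0 => y /andP[yA yx]; apply: mulr_le0_ge0; last exact: sqr_ge0.
  by rewrite subr_le0; apply: off => //; rewrite eq_sym.
have s1 := gram_pow_sum_ge0 _ _ _ A u 1.
have s3 := gram_pow_sum_ge0 _ _ _ A u 3.
have := gram_sqr_sum_ge _ _ _ A u; rewrite (eq_bigr _ diag) sumr_const.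
move: up; rewrite sum_cubic -[D *+ _]mulr_natl -/g.
set S1 := \sum_(x in A) _ in s1 *; set S3 := \sum_(x in A) _ in s3 *.
set S2 := \sum_(x in A) _.
move: S1 S2 S3 s1 s3; rewrite -/g.
set n : R := #|P|%:R in DJ JD bE *; set N : R := #|A|%:R.
have n0 : 0 < n by rewrite -(pmulr_lgt0 _ J0); clear -D0 DJ; lra.
have N0 : 0 <= N by [].
clearbody n N; clear diag off g u A => S1 S2 S3 S10 S30 up S2N.
have h1 : 0 <= (b ^+ 2 - 2 * J * b) * S1.
  apply: mulr_ge0 => //; have -> : b ^+ 2 - 2 * J * b = (b - 2 * J) * b by ring.
  by apply: mulr_ge0; [lra | exact: ltW].
have h2 : (2 * b - J) * S2 <= N * (D * (2 * D) ^+ 2) + J * b ^+ 2 * N ^+ 2.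
  clear -h1 S30 up; lra.
have h3 : (2 * b - J) * (N * D) ^+ 2
  <= N * (D * (2 * D) ^+ 2) * n + n * J * b * b * N ^+ 2.
  have h4 : (2 * b - J) * (N * D) ^+ 2 <= (2 * b - J) * (n * S2).
    by apply: ler_wpM2l => //; clear -b0 bJ J0; lra.
  apply: le_trans h4 _; rewrite mulrCA mulrC.
  have := ler_wpM2r (ltW n0) h2; congr (_ <= _); ring.
(* By the choice of b, the last term of [h3] is b / 2 times [(N * D) ^+ 2]. *)
have h5 : n * J * b = D ^+ 2 / 2 by rewrite -bE; field.
rewrite h5 in h3.
have h6 : b * N ^+ 2 * D ^+ 2 <= N * (D * (2 * D) ^+ 2) * n.
  have h7 : 0 <= (b / 2 - J) * (N * D) ^+ 2.
    by apply: mulr_ge0; [clear -bJ; lra | exact: sqr_ge0].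
  clear -h3 h7; lra.
have h8 : N * b <= 4 * D * n.
  have [->|Nn0] := eqVneq N 0.
    by rewrite mul0r !mulr_ge0 // ltW.
  have ND : 0 < N * D ^+ 2 by rewrite mulr_gt0 ?exprn_gt0 // lt0r Nn0.
  rewrite -(ler_pM2l ND); apply: le_trans (le_trans h6 _).
    by rewrite le_eqVlt; apply/orP; left; apply/eqP; ring.
  by rewrite le_eqVlt; apply/orP; left; apply/eqP; ring.
rewrite -(ler_pM2r D0) -[N * D * D]mulrA -[D * D]expr2 -bE.
have nJ : 0 <= 2 * n * J by rewrite !mulr_ge0 // ltW.
by have := ler_wpM2r nJ h8; congr (_ <= _); ring.
Qed.

(** * Size of codes just below the Plotkin range *)

(** The letter t is encoded by the vector whose coordinate at a letter a is
    [#|T|] - 1 if a = t and - 1 otherwise: up to scaling these are the vertices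
    of a regular simplex, and so words are far apart exactly when their inner
    product is small. *)
Lemma simplex_gram (R : realFieldType) (I T : finType) (w w' : I -> T) :
  \sum_(p : I * T) (#|T|%:R * (w p.1 == p.2)%:R - 1)
                   * (#|T|%:R * (w' p.1 == p.2)%:R - 1)
  = #|T|%:R * (#|T|%:R * #|[set i | w i == w' i]|%:R - #|I|%:R) :> R.
Proof.
rewrite -(pair_bigA _ (fun i a => (#|T|%:R * (w i == a)%:R - 1)
                   * (#|T|%:R * (w' i == a)%:R - 1))) /=.
have -> : #|[set i | w i == w' i]|%:R = \sum_i (w i == w' i)%:R :> R.
  by rewrite -sum1dep_card natr_sum big_mkcond; apply: eq_bigr => i _; case: eqP.
have -> : #|I|%:R = \sum_(i : I) (1 : R) by rewrite sumr_const.
rewrite mulr_sumr -sumrB mulr_sumr; apply: eq_bigr => i _.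
have indic (a : T) (F : T -> R) : \sum_b (a == b)%:R * F b = F a.
  rewrite (bigD1 a) //= eqxx mul1r big1 ?addr0 // => b /negPf.
  by rewrite eq_sym => ->; rewrite mul0r.
transitivity (\sum_b ((w i == b)%:R * (#|T|%:R * (#|T|%:R * (w' i == b)%:R - 1))
                      - (w' i == b)%:R * #|T|%:R + (1 : R))).
  by apply: eq_bigr => b _; ring.
rewrite big_split sumrB /= !indic sumr_const eq_sym.
by ring.
Qed.

(** The hypothesis on the agreements says that the distances are at least
    (1 - 1/q) [#|I|] - E / q, where q = [#|T|], that is, that E measures how far
    below the Plotkin distance the code may go. *)
Lemma code_size_bound (V I T : finType) (A : {set V}) (w : V -> I -> T)
    (E : nat) :
    (1 < #|T|)%N -> (0 < #|I|)%N -> (0 < E)%N ->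
    (forall x y, x \in A -> y \in A -> x != y ->
       #|T| * #|[set i | w x i == w y i]| <= #|I| + E)%N ->
    (4 * #|T| * E ^ 2 <= #|I|)%N ->
  (#|A| <= 16 * #|T| * #|I| * E)%N.
Proof.
move=> T1 I0 E0 agree small.
pose u x (p : I * T) : rat := #|T|%:R * (w x p.1 == p.2)%:R - 1.
have T1R : 2 <= #|T|%:R :> rat by rewrite ler_nat.
have I0R : 0 < #|I|%:R :> rat by rewrite ltr0n.
have E1R : 1 <= E%:R :> rat by rewrite ler1n.
have [diag off] : (forall x, x \in A -> \sum_p u x p * u x p
     = #|T|%:R * (#|T|%:R - 1) * #|I|%:R) /\ (forall x y, x \in A -> y \in A ->
    x != y -> \sum_p u x p * u y p <= #|T|%:R * E%:R).
  split=> [x xA|x y xA yA xy]; rewrite simplex_gram.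
    have -> : [set i | w x i == w x i] = setT by apply/setP => i; rewrite !inE eqxx.
    by rewrite cardsT; ring.
  rewrite ler_pM2l ?ltr0n //; last exact: ltnW.
  by rewrite lerBlDl -natrM -natrD ler_nat agree.
have smallR : 4 * #|T|%:R * E%:R ^+ 2 <= #|I|%:R :> rat.
  by rewrite -natrX -!natrM ler_nat.
rewrite -(ler_nat rat) !natrM.
have := spherical_code_bound _ _ _ A u _ _ _ _ diag off.
rewrite card_prod natrM.
move: T1R I0R E1R smallR; clear.
move: #|T|%:R #|I|%:R E%:R #|A|%:R => t i e a t2 i0 e1 small bound.
have ti : 0 < t * i by rewrite mulr_gt0 //; lra.
have tt1 : 0 < t * (t - 1) by rewrite mulr_gt0 //; lra.
have {bound} : a * (t * (t - 1) * i) <= 8 * (i * t) ^+ 2 * (t * e).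
  apply: bound.
  - by rewrite mulr_gt0 //; lra.
  - by rewrite mulr_gt0.
  - rewrite -subr_ge0 (_ : _ - _ = t * i * (t * (2 * e - 1) + 1)); last by ring.
    by rewrite mulr_ge0 ?ltW // addr_gt0 // mulr_gt0 //; lra.
  have h : 4 * t * e ^+ 2 * (i * t ^+ 2) <= i * (i * t ^+ 2) * (t - 1) ^+ 2.
    apply: (@le_trans _ _ (i * (i * t ^+ 2))).
      by rewrite ler_wpM2r // mulr_ge0 ?sqr_ge0 // ltW.
    apply: ler_peMr; last by apply: exprn_ege1; lra.
    by apply: mulr_ge0; [exact: ltW | apply: mulr_ge0; rewrite ?sqr_ge0 ?ltW].
  by move: h; congr (_ <= _); ring.
have ti' : 0 < t * i / 2 by rewrite divr_gt0.
move=> bound; have a0 : 0 <= a \/ a < 0.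
  by case: (leP 0 a); [left | right].
have e0 : 0 < e by lra.
have b0 : 0 <= 16 * t * i * e by rewrite !mulr_ge0 //; lra.
case: a0 => a0; last by lra.
have tti : 0 < t ^+ 2 * i / 2 by rewrite divr_gt0 // mulr_gt0 // exprn_gt0 //; lra.
rewrite -(ler_pM2r tti).
apply: (@le_trans _ _ (a * (t * (t - 1) * i))).
  apply: ler_wpM2l => //; rewrite -subr_ge0.
  rewrite (_ : _ - _ = t * i / 2 * (t - 2)); last by field.
  by apply: mulr_ge0; [exact: ltW | lra].
by move: bound; congr (_ <= _); field.
Qed.

(** * Graphs without large cliques and with almost the maximum number of edges *)

(** Vertices are listed by a function on [nat] so that an entry can be replaced
    and a further one added without changing types; an irreflexive e forces the
    listed vertices to be distinct. *)
Definition has_clique (V : finType) (e : rel V) (k : nat) : Prop :=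
  exists h : nat -> V, forall a b, (a < b < k)%N -> e (h a) (h b).

Definition deg (V : finType) (e : rel V) (x : V) : nat := #|[set y | e x y]|.

(** The vertex x0 is a default value for empty S. *)
Definition max_deg_in (V : finType) (e : rel V) (x0 : V) (S : {set V}) : V :=
  odflt x0 [pick x in S | [forall y in S, deg V e y <= deg V e x]%N].

Fixpoint common (V : finType) (e : rel V) (x0 : V) (i : nat) : {set V} :=
  if i is i'.+1
  then let S := common V e x0 i' in S :&: [set y | e (max_deg_in V e x0 S) y]
  else setT.

Lemma max_deg_inP (V : finType) (e : rel V) (x0 : V) (S : {set V}) (x : V) :
  x \in S ->
  max_deg_in V e x0 S \in S /\ (deg V e x <= deg V e (max_deg_in V e x0 S))%N.
Proof.
move=> xS; rewrite /max_deg_in; case: pickP => [y /andP[yS /forall_inP ymax]|none] /=.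
  by split=> //; exact: ymax.
have [y yS ymax] := arg_maxnP (deg V e) xS.
have := none y; rewrite [y \in S]yS /= => /forall_inP[] z zS; exact: ymax.
Qed.

(** The Bollobas-Nikiforov greedy procedure: each term has maximum degree among
    the common neighbours of the preceding ones. The statement is phrased
    through an arbitrary common neighbour x, because nothing holds from the
    first index on at which there is none. *)
Lemma greedy_sequence (V : finType) (e : rel V) (x0 : V) :
  exists v : nat -> V, forall i x, (forall l, (l < i)%N -> e (v l) x) ->
    (forall l, (l < i)%N -> e (v l) (v i)) /\ (deg V e x <= deg V e (v i))%N.
Proof.
pose v i := max_deg_in V e x0 (common V e x0 i); exists v.
have inC i x : reflect (forall l, (l < i)%N -> e (v l) x) (x \in common V e x0 i).
  elim: i => [|i IH] /=; first by rewrite inE; left.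
  rewrite inE; apply: (iffP andP) => [[/IH xi]|xi].
    rewrite inE => ex l; rewrite ltnS leq_eqVlt => /orP[/eqP-> //|]; exact: xi.
  split; first by apply/IH => l li; apply: xi; exact: ltnW.
  by rewrite inE; exact: xi.
by move=> i x /inC/(max_deg_inP _ e x0)[/inC].
Qed.

(** Here N is the number of vertices, S the sum of the degrees, [a i] the number
    of non-neighbours of the i-th greedy vertex and [n i] the number of vertices
    of the i-th part. With t = N / q, the hypothesis on S says that
    [\sum_i n i * (a i - n i) + \sum_i (n i - t) ^+ 2] is at most the deficiency
    (1 - 1/q) N ^ 2 - S. If all parts have at least t / 2 vertices, the first
    sum controls [\sum_i (a i - n i)]; otherwise the second sum makes the
    deficiency as large as N ^ 2 / (4 q ^ 2). *)
Lemma greedy_weights (F : realFieldType) (q : nat) (n a : 'I_q -> F) (N S : F) :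
    (0 < q)%N -> 0 <= N -> \sum_i n i = N -> (forall i, 0 <= n i <= a i) ->
    S <= \sum_i n i * (N - a i) ->
  let D := 4 * q%:R * ((q%:R - 1) * N ^+ 2 - q%:R * S) in
  (N * (\sum_i a i - N) <= D /\ forall i, 0 < N -> 0 < n i)
  \/ N ^+ 2 <= D.
Proof.
move=> q0 N0 sumn na SN /=.
have q1 : 1 <= q%:R :> F by rewrite ler1n.
have q0R : 0 < q%:R :> F by rewrite ltr0n.
pose t := N / q%:R; have tE : t * q%:R = N by rewrite divfK // gt_eqF.
pose X := \sum_i n i * (a i - n i); pose Y := \sum_i (n i - t) ^+ 2.
have XY : X + Y <= N ^+ 2 - t * N - S.
  have na_sum : \sum_i n i * a i = N * N - \sum_i n i * (N - a i).
    rewrite -[X in X * N]sumn mulr_suml -sumrB.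
    by apply: eq_bigr => i _; ring.
  have t2_sum : \sum_(i < q) t ^+ 2 = t * N.
    by rewrite sumr_const card_ord -[_ *+ _]mulr_natr -tE; ring.
  have -> : X + Y = \sum_i n i * a i - 2 * t * N + t * N.
    rewrite -[in X in _ - X]sumn mulr_sumr -sumrB -t2_sum -!big_split /=.
    by apply: eq_bigr => i _; ring.
  rewrite na_sum; clear -SN; lra.
have {}XY : 4 * q%:R ^+ 2 * (X + Y) <= 4 * q%:R * ((q%:R - 1) * N ^+ 2 - q%:R * S).
  have q2 : 0 <= 4 * q%:R ^+ 2 :> F by rewrite mulr_ge0 ?sqr_ge0.
  apply: le_trans (ler_wpM2l q2 XY) _.
  rewrite le_eqVlt; apply/orP; left; apply/eqP.
  transitivity (4 * q%:R * (q%:R * N ^+ 2 - (t * q%:R) * N - q%:R * S)); first by ring.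
  by rewrite tE; ring.
have X0 : 0 <= X.
  apply: sumr_ge0 => i _; case/andP: (na i) => ni0 nai.
  by rewrite mulr_ge0 // subr_ge0.
have Y0 : 0 <= Y by apply: sumr_ge0 => i _; exact: sqr_ge0.
have [/existsP[i small]|large] := boolP [exists i, 2 * q%:R * n i < N].
  right; apply: le_trans XY; apply: (@le_trans _ _ (4 * q%:R ^+ 2 * (n i - t) ^+ 2)).
    rewrite (_ : 4 * _ * _ = (2 * (N - q%:R * n i)) ^+ 2); last by rewrite -tE; ring.
    by apply: lerXn2r; rewrite ?nnegrE; clear -small N0; lra.
  apply: ler_wpM2l; first by rewrite mulr_ge0 ?sqr_ge0.
  rewrite /Y (bigD1 i) //= addrCA lerDl.
  by rewrite addr_ge0 //; apply: sumr_ge0 => l _; exact: sqr_ge0.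
left; have {}large i : N <= 2 * q%:R * n i.
  by rewrite leNgt; apply: contra large => small; apply/existsP; exists i.
split=> [|i Npos]; last first.
  by rewrite -(pmulr_rgt0 _ q0R); have := large i; clear -Npos; lra.
apply: le_trans XY; apply: (@le_trans _ _ (2 * q%:R * X)).
  rewrite -[in X in _ - X]sumn -sumrB !mulr_sumr; apply: ler_sum => i _.
  rewrite mulrA; apply: ler_wpM2r => //; case/andP: (na i) => _.
  by rewrite subr_ge0.
rewrite mulrDr; apply: (@le_trans _ _ (4 * q%:R ^+ 2 * X)).
  rewrite ler_wpM2r // -subr_ge0.
  rewrite (_ : _ - _ = 2 * q%:R * (2 * q%:R - 1)); last by ring.
  by apply: mulr_ge0; clear -q1; lra.
by rewrite lerDl mulr_ge0 // mulr_ge0 ?sqr_ge0.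
Qed.

(** Each vertex gets the index of the first greedy vertex that it is not
    adjacent to; a vertex adjacent to all of them would complete a clique. *)
Lemma greedy_colour (V : finType) (e : rel V) (q : nat) (v : nat -> V) :
    (forall i x, (forall l, (l < i)%N -> e (v l) x) ->
       forall l, (l < i)%N -> e (v l) (v i)) ->
    ~ has_clique V e q.+1 ->
  exists col : V -> 'I_q, forall x,
    ~~ e (v (col x)) x /\ forall l, (l < col x)%N -> e (v l) x.
Proof.
move=> greedy free.
suff : forall x, exists i : 'I_q, ~~ e (v i) x /\ forall l, (l < i)%N -> e (v l) x.
  by case/fin_all_exists => col colP; exists col.
move=> x; have [] := boolP [exists i : 'I_q, ~~ e (v i) x].
  case/existsP => i0 mi0; case: (@arg_minnP _ i0 (fun i => ~~ e (v i) x) val mi0) => i mi imin.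
  exists i; split=> // l li; apply/negPn/negP => ml.
  by have := imin (Ordinal (ltn_trans li (ltn_ord i))) ml; rewrite leqNgt li.
rewrite negb_exists => /forallP adj.
have {}adj l : (l < q)%N -> e (v l) x.
  by move=> lq; have := adj (Ordinal lq); rewrite negbK.
case: free; exists (fun a => if (a < q)%N then v a else x) => a b /andP[ab].
rewrite ltnS => bq; rewrite (leq_trans ab bq).
case: ifP => [bq'|_]; last by apply: adj; exact: leq_trans bq.
by apply: (greedy b x) => // l lb; apply: adj; exact: ltn_trans bq'.
Qed.

(** Two adjacent vertices, both adjacent to all vertices of a clique but one,
    can replace that one and produce a larger clique. *)
Lemma swap_clique (V : finType) (e : rel V) (q : nat) (v : nat -> V) (i : nat)
    (x y : V) :
    symmetric e -> (i < q)%N -> e x y ->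
    (forall a b, (a < b < q)%N -> e (v a) (v b)) ->
    (forall l, (l < q)%N -> l != i -> e (v l) x /\ e (v l) y) ->
  has_clique V e q.+1.
Proof.
move=> esym iq exy vv vxy.
exists (fun a => if a == q then y else if a == i then x else v a) => a b /andP[ab].
rewrite ltnS => bq; have aq := leq_trans ab bq; rewrite (ltn_eqF aq).
have [_|bNq] := eqVneq b q.
  by have [//|ai] := eqVneq a i; exact: (vxy a aq ai).2.
have {}bq : (b < q)%N by rewrite ltn_neqAle bNq.
have [ai|ai] := eqVneq a i; have [bi|bi] := eqVneq b i.
- by rewrite ai bi ltnn in ab.
- by rewrite esym; exact: (vxy b bq bi).1.
- exact: (vxy a aq ai).1.
- by apply: vv; rewrite ab.
Qed.

(** Stability in Turan's theorem with a linear number of deleted vertices. The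
    exceptional set B consists of the vertices that miss at least two of the q
    greedy vertices: an edge inside a part and off B would produce a
    larger clique by [swap_clique]. Every vertex misses at least one greedy
    vertex and those of B at least two, so [#|B|] is at most the total number of
    non-neighbours of the greedy vertices minus [#|V|], which [greedy_weights]
    controls. When its second alternative holds, the bound allows B to be the
    whole vertex set. *)
Lemma turan_stability (V : finType) (e : rel V) (q : nat) (x0 : V) :
    symmetric e -> (0 < q)%N -> ~ has_clique V e q.+1 ->
  exists (B : {set V}) (col : V -> 'I_q),
    (forall x y, x \notin B -> y \notin B -> e x y -> col x != col y) /\
    (#|B| * #|V| + 4 * q ^ 2 * \sum_x deg V e x <= 4 * q * (q - 1) * #|V| ^ 2)%N.
Proof.
move=> esym q0 free; have [v vP] := greedy_sequence V e x0.
have [|col colP] := greedy_colour V e q v _ free.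
  by move=> i x /vP[].
pose n (i : 'I_q) := #|[set x | col x == i]|.
pose a (i : 'I_q) := #|[set x | ~~ e (v i) x]|.
have degE (i : 'I_q) : (deg V e (v i) + a i = #|V|)%N.
  rewrite /deg /a -(cardsC [set y | e (v i) y]); congr (_ + _)%N.
  by apply: eq_card => x; rewrite !inE.
have na i : (n i <= a i)%N.
  by apply: subset_leq_card; apply/subsetP => x; rewrite !inE => /eqP <-; case: (colP x).
have sum_n : (\sum_i n i = #|V|)%N.
  rewrite -sum1_card (partition_big col predT) //=; apply: eq_bigr => i _.
  by rewrite sum1dep_card.
have sum_deg : (\sum_x deg V e x <= \sum_i n i * deg V e (v i))%N.
  rewrite (partition_big col predT) //=; apply: leq_sum => i _.
  rewrite /n -sum1dep_card big_distrl /=; apply: leq_sum => x /eqP xi.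
  rewrite mul1n; apply: (vP i x _).2 => l; rewrite -xi; exact: (colP x).2.
have finish b : (b%:R * #|V|%:R <= 4 * q%:R * ((q%:R - 1) * #|V|%:R ^+ 2
      - q%:R * (\sum_x deg V e x)%:R) :> rat) ->
    (b * #|V| + 4 * q ^ 2 * \sum_x deg V e x <= 4 * q * (q - 1) * #|V| ^ 2)%N.
  move=> h; rewrite -(ler_nat rat) -!mulnn natrD !natrM (natrB _ q0).
  by rewrite -lerBrDr; move: h; congr (_ <= _); ring.
have [||i||[big pos]|big] := greedy_weights rat q (fun i => (n i)%:R) (fun i => (a i)%:R)
   #|V|%:R (\sum_x deg V e x)%:R q0.
- by [].
- by rewrite -natr_sum sum_n.
- by rewrite ler0n ler_nat na.
- apply: (@le_trans _ _ (\sum_i n i * deg V e (v i))%N%:R); first by rewrite ler_nat.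
  rewrite natr_sum; apply: ler_sum => i _.
  by rewrite -(degE i) natrD addrK natrM.
- exists [set x | [exists (i | i != col x), ~~ e (v i) x]], col; split; last first.
    apply: finish; rewrite mulrC; apply: le_trans big; apply: ler_wpM2l => //.
    rewrite lerBrDl -natr_sum -natrD ler_nat.
    have -> : (\sum_i a i = \sum_x #|[set i : 'I_q | ~~ e (v i) x]|)%N.
      rewrite /a; under eq_bigr do rewrite -sum1dep_card big_mkcond.
      by rewrite exchange_big; apply: eq_bigr => x _; rewrite -big_mkcond sum1dep_card.
    rewrite -(sum1_card V) -sum1dep_card [X in (_ + X)%N]big_mkcond -big_split /=.
    apply: leq_sum => x _; have [mx _] := colP x.
    rewrite (cardsD1 (col x)) inE mx leq_add2l; case: ifP => // /existsP[i /andP[ix mi]].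
    by apply/card_gt0P; exists i; rewrite !inE ix.
  move=> x y; rewrite !inE !negb_exists => /forallP xB /forallP yB exy.
  apply/eqP => cxy; apply: free.
  apply: (swap_clique V e q v (col x) x y) => //.
    move=> b c /andP[bc cq].
    (* A nonempty part provides a common neighbour of the earlier greedy
       vertices, without which the greedy sequence need not be a clique. *)
    have : (0 < n (Ordinal cq))%N.
      by rewrite -(ltr_nat rat) pos // ltr0n; apply/card_gt0P; exists x.
    case/card_gt0P => z; rewrite inE => /eqP zc.
    have [_ adj] := colP z; rewrite zc in adj.
    exact: (vP c z adj).1.
  move=> l lq lx; have := xB (Ordinal lq); have := yB (Ordinal lq).
  by rewrite -cxy -val_eqE /= lx /= !negbK.
- exists setT, col; split; first by move=> x y; rewrite inE.
  by apply: finish; rewrite cardsT -expr2.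
Qed.

Local Open Scope nat_scope.

(** * From colourings to codes: the upper bound *)

Definition colour_graph (N r : nat) (f : {set 'I_N} -> {set 'I_r}) (c : 'I_r) :
  rel 'I_N := fun x y => (x != y) && (c \in f [set x; y]).

Lemma colour_graph_sym (N r : nat) (f : {set 'I_N} -> {set 'I_r}) (c : 'I_r) :
  symmetric (colour_graph N r f c).
Proof. by move=> x y; rewrite /colour_graph eq_sym setUC. Qed.

Lemma colour_graph_clique (N r k : nat) (f : {set 'I_N} -> {set 'I_r}) (c : 'I_r) :
  has_clique _ (colour_graph N r f c) k -> has_mono_clique k f.
Proof.
move=> [h hP]; pose g (a : 'I_k) := h a.
have gP (a b : 'I_k) : a != b -> colour_graph N r f c (g a) (g b).
  rewrite -val_eqE neq_ltn => /orP[ab|ba].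
    by apply: hP; rewrite ab /=.
  by rewrite colour_graph_sym; apply: hP; rewrite ba /=.
have g_inj : injective g.
  move=> a b gab; apply/eqP/negPn/negP => /gP.
  by rewrite gab /colour_graph eqxx.
exists [set g a | a : 'I_k], c; split; first by rewrite card_imset // card_ord.
move=> e /eqP/cards2P[x [y [xy ->]]] /subsetP sub.
have /imsetP[a _ xa] := sub x (set21 _ _).
have /imsetP[b _ yb] := sub y (set22 _ _).
have ab : a != b by apply: contra_neq xy => ab; rewrite xa yb ab.
by have /andP[_] := gP a b ab; rewrite -xa -yb.
Qed.

(** Each of the edges at x carries exactly s colours. *)
Lemma sum_colour_deg (N r s : nat) (f : {set 'I_N} -> {set 'I_r}) (x : 'I_N) :
  set_coloring s f -> \sum_c deg _ (colour_graph N r f c) x = N.-1 * s.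
Proof.
move=> fs; rewrite /deg; under eq_bigr do rewrite -sum1dep_card big_mkcond.
rewrite exchange_big (bigD1 x) //= big1 ?add0n => [|c _]; last first.
  by rewrite /colour_graph eqxx.
transitivity (\sum_(y < N | y != x) s).
  apply: eq_bigr => y yx; rewrite -big_mkcond /= -(fs [set x; y]).
    rewrite -sum1_card; apply: eq_bigl => c.
    by rewrite /colour_graph eq_sym yx.
  by rewrite cards2 eq_sym yx.
rewrite sum_nat_const; congr (_ * _).
by rewrite -[N in RHS]card_ord -(cardC1 x).
Qed.

Lemma sum_membership (V I : finType) (B : I -> {set V}) :
  \sum_x #|[set c | x \in B c]| = \sum_c #|B c|.
Proof.
under eq_bigr do rewrite -sum1dep_card big_mkcond.
rewrite exchange_big; apply: eq_bigr => c _.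
by rewrite -big_mkcond sum1_card.
Qed.

(** Markov's inequality at twice the mean. *)
Lemma card_le_twice (V : finType) (b : V -> nat) (K : nat) :
  0 < K -> 2 * \sum_x b x <= K * #|V| -> #|V| <= 2 * #|[set x | b x <= K]|.
Proof.
move=> K0 sumb; rewrite -(cardsC [set x | b x <= K]) mul2n -addnn leq_add2l.
rewrite -(leq_pmul2l K0) in sumb *; set A := [set x | b x <= K].
have : K * #|~: A| <= \sum_x b x.
  rewrite -sum1_card big_distrr /= [X in _ <= X](bigID (mem (~: A))) /=.
  apply: leq_trans (leq_addr _ _); apply: leq_sum => x.
  by rewrite !inE -ltnNge muln1 => /ltnW.
have := cardsC A; move: sumb; set a := #|A|; set a' := #|~: A|; nia.
Qed.

(** The total S of the sizes of the exceptional sets in [turan_stability], summed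
    over the r colours: since the colour degrees add up to [N * (N.-1 * s)], the
    total deficiency is (1 - 1/q) (j N + r - j) N, and r <= N. *)
Lemma exceptional_total (q r j s N S : nat) :
    0 < q -> 0 < j <= r -> r <= N -> q * s = (q - 1) * (r - j) ->
    S * N + 4 * q ^ 2 * (N * (N.-1 * s)) <= r * (4 * q * (q - 1) * N ^ 2) ->
  S <= 8 * q ^ 2 * j * N.
Proof.
move=> q0 /andP[j0 jr] rN; have N0 : 0 < N by exact: leq_trans (leq_trans j0 jr) rN.
case: N N0 rN => // M _ rN; case: q q0 => // p _; rewrite subn1 /=.
have [t rE] : exists t, r = t + j by exists (r - j); rewrite subnK.
subst r; rewrite addnK => sE H.
have {}H : S + 4 * p.+1 * M * (p.+1 * s) <= 4 * p.+1 * p * (M.+1 * (t + j)).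
  rewrite -(leq_pmul2r (ltn0Sn M)); move: H; congr (_ <= _); ring.
have {}H : S <= 4 * p.+1 * p * (t + M.+1 * j).
  rewrite -(leq_add2r (4 * p.+1 * M * (p.+1 * s))); apply: leq_trans H _.
  by rewrite sE; apply: eq_leq; ring.
apply: leq_trans H _.
rewrite (_ : 8 * _ * _ * _ = 4 * p.+1 * p.+1 * (M.+1 * j + M.+1 * j)); last by ring.
apply: leq_mul; first by rewrite leq_mul.
rewrite leq_add2r; apply: leq_trans (leq_pmulr _ j0).
exact: leq_trans (leq_addr _ _) rN.
Qed.

(** The vertices exceptional in at most [16 * q ^ 2 * j] colours, twice the
    bound on the mean, are at least half of all. The word of such a vertex lists
    its parts in the q-partite graphs that [turan_stability] provides for the r
    colours. Two words differ in each of the s colours of the edge joining the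
    vertices, except for those in which one end is exceptional, so that
    [code_size_bound] applies with [E = 33 * q ^ 3 * j]; whence
    4356 = 4 * 33 ^ 2 and 1056 = 2 * 16 * 33. *)
Lemma set_ramsey_upper (q r j s N : nat) :
    1 < q -> 0 < j -> q * s = (q - 1) * (r - j) ->
    4356 * q ^ 7 * j ^ 2 <= r -> 1056 * q ^ 4 * r * j < N ->
  set_ramsey_prop q.+1 r s N.
Proof.
move=> q1 j0 sE small big f fs; apply: contrapT => nomono.
have q0 : 0 < q by exact: ltnW.
have jr : j <= r.
  apply: leq_trans small; rewrite -mulnn mulnA leq_pmull //.
  by rewrite !muln_gt0 ?expn_gt0 ?q0 j0.
have r0 : 0 < r by exact: leq_trans jr.
have rN : r <= N.
  apply: leq_trans (ltnW big); rewrite mulnAC leq_pmull //.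
  by rewrite !muln_gt0 ?expn_gt0 ?q0 j0.
have N0 : 0 < N by exact: leq_trans rN.
have stab c : exists p : {set 'I_N} * ('I_N -> 'I_q),
    (forall x y, x \notin p.1 -> y \notin p.1 -> colour_graph N r f c x y ->
       p.2 x != p.2 y) /\
    #|p.1| * N + 4 * q ^ 2 * \sum_x deg _ (colour_graph N r f c) x
      <= 4 * q * (q - 1) * N ^ 2.
  have free : ~ has_clique _ (colour_graph N r f c) q.+1.
    by move/colour_graph_clique.
  have := turan_stability _ _ q (Ordinal N0) (colour_graph_sym N r f c) q0 free.
  by rewrite card_ord => -[B [col H]]; exists (B, col).
have [p pP] := fin_all_exists stab.
pose bad x := #|[set c | x \in (p c).1]|.
have sum_bad : \sum_x bad x <= 8 * q ^ 2 * j * N.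
  rewrite /bad sum_membership; apply: (@exceptional_total q r j s) => //.
    by rewrite j0.
  have : \sum_c (#|(p c).1| * N
          + 4 * q ^ 2 * \sum_x deg _ (colour_graph N r f c) x)
     <= \sum_(c < r) 4 * q * (q - 1) * N ^ 2.
    by apply: leq_sum => c _; case: (pP c).
  rewrite big_split /= -big_distrl -big_distrr exchange_big /=.
  under [X in _ + _ * X <= _]eq_bigr do rewrite (sum_colour_deg _ _ _ _ _ fs).
  by rewrite !sum_nat_const !card_ord.
pose K := 16 * q ^ 2 * j; pose A := [set x | bad x <= K].
have NA : N <= 2 * #|A|.
  rewrite -[X in X <= _]card_ord; apply: card_le_twice.
    by rewrite /K !muln_gt0 ?expn_gt0 ?q0.
  rewrite card_ord /K; apply: leq_trans (leq_mul (leqnn 2) sum_bad) _.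
  by rewrite !mulnA.
have agree x y : x \in A -> y \in A -> x != y ->
    #|'I_q| * #|[set c | (p c).2 x == (p c).2 y]| <= #|'I_r| + 33 * q ^ 3 * j.
  rewrite !inE !card_ord => xA yA xy.
  have cover : f [set x; y] \subset ~: [set c | (p c).2 x == (p c).2 y]
      :|: ([set c | x \in (p c).1] :|: [set c | y \in (p c).1]).
    apply/subsetP => c cf; rewrite !inE.
    have [_|xB] := boolP (x \in _); first by rewrite orbT.
    have [_|yB] := boolP (y \in _); first by rewrite !orbT.
    by rewrite /= orbF; apply: (pP c).1 => //; rewrite /colour_graph xy.
  (* K for the colours where x is exceptional and K for those of y. *)
  have s_le : s <= (r - #|[set c | (p c).2 x == (p c).2 y]|) + (K + K).
    rewrite -(fs [set x; y]); last by rewrite cards2 xy.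
    apply: leq_trans (subset_leq_card cover) _.
    apply: leq_trans (leq_card_setU _ _) _; rewrite cardsCs setCK card_ord.
    rewrite leq_add2l; apply: leq_trans (leq_card_setU _ _) _.
    exact: leq_add.
  have ar : #|[set c | (p c).2 x == (p c).2 y]| <= r.
    by rewrite -[X in _ <= X](card_ord r) max_card.
  move: s_le ar; set a := #|_|; clearbody a; move=> s_le ar.
  have qa : q * a + q * s <= q * r + q * (K + K).
    rewrite -!mulnDr leq_mul2l; apply/orP; right; lia.
  have qr : q * r = (r + (q - 1) * j) + (q - 1) * (r - j).
    by rewrite -addnA -mulnDr subnKC // -{2}[r]mul1n -mulnDl subnKC.
  rewrite -(leq_add2r (q * s)); apply: leq_trans qa _.
  rewrite qr sE -addnA [_ * (r - j) + _]addnC addnA leq_add2r -addnA leq_add2l.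
  have -> : q * (K + K) = 32 * q ^ 3 * j by rewrite /K; ring.
  rewrite (_ : 33 * q ^ 3 * j = q ^ 3 * j + 32 * q ^ 3 * j); last by ring.
  rewrite leq_add2r leq_mul2r; apply/orP; right.
  by apply: leq_trans (leq_subr _ _) _; rewrite -{1}[q]expn1 leq_pexp2l.
have := @code_size_bound _ _ _ A (fun x c => (p c).2 x) (33 * q ^ 3 * j) _ _ _ agree.
rewrite !card_ord => /(_ q1 r0) bound.
have {bound} : #|A| <= 16 * q * r * (33 * q ^ 3 * j).
  apply: bound.
    by rewrite !muln_gt0 ?expn_gt0 ?q0.
  apply: leq_trans small; apply: eq_leq; ring.
rewrite leqNgt => /negP; apply.
rewrite -(ltn_pmul2l (ltn0Sn 1)); apply: leq_trans NA; apply: leq_trans big.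
rewrite ltnS; apply: eq_leq; ring.
Qed.

(** * From codes to colourings *)

(** A pair of codewords is coloured by s of the positions in which they differ.
    In a clique of colour c the letters at position c are pairwise distinct. *)
Lemma code_refutes_ramsey (q r s N : nat) (C : {set {ffun 'I_r -> 'I_q}}) :
  min_dist_ge C s -> N <= #|C| -> ~ set_ramsey_prop q.+1 r s N.
Proof.
move=> /forall_inP distC NC ramsey.
pose w (x : 'I_N) : {ffun 'I_r -> 'I_q} := enum_val (widen_ord NC x).
have w_inj : injective w by move=> x y /enum_val_inj/(congr1 val)/= /val_inj.
have dist x y : x != y -> s <= #|[set i | w x i != w y i]|.
  move=> xy; have /forall_inP := distC _ (enum_valP (widen_ord NC x)).
  move/(_ _ (enum_valP (widen_ord NC y)))/implyP; apply.
  by rewrite (inj_eq w_inj).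
pose D (e : {set 'I_N}) := [set i | [exists x in e, exists y in e, w x i != w y i]].
pose f e := odflt set0 [pick T : {set 'I_r} | (T \subset D e) && (#|T| == s)].
have fP (e : {set 'I_N}) : #|e| = 2 -> f e \subset D e /\ #|f e| = s.
  move=> /eqP/cards2P[x [y [xy ->]]]; rewrite /f.
  case: pickP => [T /andP[TD /eqP Ts]|none]; first by split.
  have sD : s <= #|D [set x; y]|.
    apply: leq_trans (dist _ _ xy) _; apply: subset_leq_card.
    apply/subsetP => i; rewrite !inE => wi; apply/exists_inP.
    by exists x; [rewrite set21 | apply/exists_inP; exists y; rewrite ?set22].
  have /negbT/negP[] := none [set i in take s (enum (D [set x; y]))].
  apply/andP; split.
    by apply/subsetP => i; rewrite inE => /mem_take; rewrite mem_enum.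
  rewrite cardsE (card_uniqP _) ?take_uniq ?enum_uniq //.
  by rewrite size_take -cardE; case: ltngtP sD => // ->.
have [e /fP[] //|S [c [cardS mono]]] := ramsey f.
have : #|[set w x c | x in S]| <= q.
  by rewrite -[X in _ <= X](card_ord q) max_card.
rewrite card_in_imset ?cardS ?ltnn // => x y xS yS wxy.
apply/eqP/negPn/negP => xy.
have e2 : #|[set x; y]| = 2 by rewrite cards2 xy.
have [sub _] := fP _ e2.
have /(subsetP sub) : c \in f [set x; y].
  by apply: mono => //; apply/subsetP => z; rewrite !inE => /orP[]/eqP->.
rewrite inE => /exists_inP[x' x'e /exists_inP[y' y'e]].
by move: x'e y'e; rewrite !inE => /orP[]/eqP-> /orP[]/eqP->; rewrite ?wxy eqxx.
Qed.

Lemma max_code_size_lt_ramsey (q r s N : nat) :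
  set_ramsey_prop q.+1 r s N -> max_code_size q r s < N.
Proof.
case: N => [|N] ramsey.
  have dist0 : @min_dist_ge q r set0 s by apply/forall_inP => x; rewrite inE.
  by case: (code_refutes_ramsey _ _ _ _ _ dist0 (leq0n _) ramsey).
rewrite ltnS; apply/bigmax_leqP => C distC; rewrite leqNgt; apply/negP => NC.
exact: code_refutes_ramsey distC NC ramsey.
Qed.

(** * Concatenated ovoid codes: the lower bound *)

Definition separated (W I T : finType) (w : W -> I -> T) (d : nat) : Prop :=
  forall x y, x != y -> d <= #|[set i | w x i != w y i]|.

Lemma card_set_option (I : finType) (P : pred (option I)) :
  #|[set o | P o]| = P None + #|[set i | P (Some i)]|.
Proof.
rewrite -!sum1dep_card big_mkcond (bigD1 None) //= -big_mkcondr.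
congr (_ + _).
rewrite (reindex_omap Some id) => [|[]//].
by apply: eq_bigl => i; rewrite eqxx andbT.
Qed.

Lemma card_set_pair (I J : finType) (P : I -> J -> bool) :
  #|[set p | P p.1 p.2]| = \sum_i #|[set j | P i j]|.
Proof.
rewrite -sum1dep_card big_mkcond -(pair_bigA _ (fun i j => if P i j then 1 else 0)).
by apply: eq_bigr => i _; rewrite -sum1dep_card -big_mkcond.
Qed.

(** The recursive form of the simplex code. A word (u, a) of the next code has
    the letters [u i + t * a], for all positions i and field elements t, and one
    more letter a. Words with the same a differ as u and v do, for every t;
    words with different a agree at exactly one t for every i. Equidistance is
    thus inherited without reference to projective points. *)
Lemma simplex_code (F : finFieldType) (m : nat) :
  exists (W I : finType) (w : W -> I -> F),
    [/\ #|W| = #|F| ^ m, #|I| * (#|F| - 1) = #|F| ^ m - 1 &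
     forall x y, x != y -> #|F| * #|[set i | w x i != w y i]| = #|F| ^ m].
Proof.
have F0 : 0 < #|F| by apply/card_gt0P; exists 0%R.
elim: m => [|m [W [I [w [cardW cardI dist]]]]].
  exists unit, void, (fun _ => of_void F); split; rewrite ?card_unit ?card_void //.
have Fm : 0 < #|F| ^ m by rewrite expn_gt0 F0.
exists (W * F)%type, (option (I * F))%type.
exists (fun u o => if o is Some p then w u.1 p.1 + p.2 * u.2 else u.2)%R.
split.
- by rewrite card_prod cardW expnSr.
- rewrite card_option card_prod -addn1 mulnDl mul1n mulnAC cardI mulnBl mul1n -expnSr.
  rewrite addnBA // subnK // expnS; exact: leq_pmulr.
move=> [u a] [v b] uv; rewrite card_set_option /=.
rewrite (card_set_pair _ _ (fun i t => w u i + t * a != w v i + t * b)%R).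
rewrite expnS; congr (_ * _).
have [ab|ab] := eqVneq a b.
  rewrite -ab add0n -(dist u v); last first.
    by apply: contra_neq uv => ->; rewrite ab.
  rewrite -[in RHS]sum1dep_card big_distrr [RHS]big_mkcond /=; apply: eq_bigr => i _.
  have [wi|wi] := eqVneq (w u i) (w v i).
    by apply/eqP; rewrite cards_eq0; apply/eqP/setP => t; rewrite !inE wi eqxx.
  rewrite muln1 -cardsT; congr #|pred_of_set _|; apply/setP => t.
  by rewrite !inE (inj_eq (addIr _)).
transitivity (1 + #|I| * (#|F| - 1)); last by rewrite cardI subnKC.
congr (1 + _); rewrite -sum_nat_const; apply: eq_bigr => i _.
rewrite subn1 -(cardsC1 ((w v i - w u i) / (a - b))%R).
congr #|pred_of_set _|; apply/setP => t; rewrite !inE; congr (~~ _).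
have ab0 : (a - b != 0)%R by rewrite subr_eq0.
rewrite -[RHS](inj_eq (mulIf ab0)) divfK // mulrBr -subr_eq0 -[RHS]subr_eq0.
by congr (_ == _)%R; ring.
Qed.

Lemma card_roots_lt (F : finFieldType) (p : {poly F}) :
  p != 0%R -> #|[set x | root p x]| < size p.
Proof.
move=> p0; rewrite cardE; apply: max_poly_roots => //; last exact: enum_uniq.
by apply/allP => x; rewrite mem_enum inE.
Qed.

(** For Q > 1 the four exponents 0, 1, Q, Q + 1 are distinct, so this is a
    nonzero polynomial of degree at most Q + 1, and at most Q if d = 0. *)
Lemma card_zeros_qpoly (F : finFieldType) (Q : nat) (a b c d : F) :
    1 < Q -> [|| a != 0, b != 0, c != 0 | d != 0]%R ->
  #|[set x : F | a + b * x + c * x ^+ Q + d * x ^+ Q.+1 == 0]%R| <= Q + (d != 0)%R.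
Proof.
move=> Q1 nz.
pose p : {poly F} := (a%:P + b *: 'X + c *: 'X^Q + d *: 'X^(Q.+1))%R.
have pE j : (p`_j = a * (j == 0)%:R + b * (j == 1)%:R + c * (j == Q)%:R
                + d * (j == Q.+1)%:R)%R.
  rewrite !coefD !coefZ coefX !coefXn coefC.
  by case: (j == 0); rewrite ?mulr1 ?mulr0.
have p0 : p != 0%R.
  have Q0 : 0 < Q by exact: ltnW.
  have nQ : (Q == 0) = false by exact: gtn_eqF.
  have nQ1 : (Q == 1) = false by exact: gtn_eqF.
  have nQS : (Q.+1 == Q) = false by exact: gtn_eqF.
  have nE := (nQ, nQ1, nQS, eq_sym 0 Q, eq_sym 1 Q, eq_sym Q Q.+1, eqSS, eqxx, mulr0, mulr1, addr0, add0r).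
  apply/eqP => p0; have z j : (p`_j = 0)%R by rewrite p0 coef0.
  have := z Q.+1; have := z Q; have := z 1; have := z 0.
  rewrite !pE !nE /= => a0 b0 c0 d0.
  by move: nz; rewrite a0 b0 c0 d0 eqxx.
have sz : size p <= Q.+1 + (d != 0)%R.
  apply/leq_sizeP => j jQ; rewrite pE.
  have Qj : Q < j by apply: leq_trans jQ; exact: leq_addr.
  rewrite (gtn_eqF Qj) (gtn_eqF (ltn_trans Q1 Qj)) (gtn_eqF (ltn_trans (ltnW Q1) Qj)).
  rewrite !mulr0 !add0r.
  have [->|d0] := eqVneq d 0%R; first by rewrite mul0r.
  by rewrite gtn_eqF ?mulr0 //; move: jQ; rewrite d0 addn1.
have -> : [set x : F | a + b * x + c * x ^+ Q + d * x ^+ Q.+1 == 0]%R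
    = [set x | root p x].
  by apply/setP => x; rewrite !inE rootE /p !hornerE.
by rewrite -ltnS; apply: leq_trans (card_roots_lt _ p p0) _; rewrite -addSn.
Qed.

(** A subfield count by means of root counting only. The additive map
    [g x = x ^+ Q - x] has the fixed points as kernel, of size at most Q, and its
    values are roots of [y ^+ Q + y], so its image has at most Q elements too.
    As the product of the two sizes is [Q ^ 2], both bounds are attained. *)
Lemma card_frobenius_fixed (F : finFieldType) (Q : nat) :
    1 < Q -> (forall x y : F, (x + y) ^+ Q = x ^+ Q + y ^+ Q)%R ->
    #|F| = Q ^ 2 ->
  #|[set x : F | x ^+ Q == x]%R| = Q.
Proof.
move=> Q1 frobD cardF; have Q0 : 0 < Q by exact: ltnW.
have frobB (x y : F) : ((x - y) ^+ Q = x ^+ Q - y ^+ Q)%R.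
  by rewrite -[in RHS](subrK y x) [in RHS]frobD addrK.
have frobK (x : F) : (x ^+ Q ^+ Q = x)%R by rewrite -exprM mulnn -cardF expf_card.
set K := [set x | _]; apply/eqP; rewrite eqn_leq; apply/andP; split.
  have := @card_zeros_qpoly F Q 0%R (- 1)%R 1%R 0%R Q1; rewrite oner_eq0 oppr_eq0 oner_eq0 eqxx.
  rewrite addn0; move/(_ isT); apply: leq_trans; apply: subset_leq_card.
  by apply/subsetP => x; rewrite !inE => /eqP ->; apply/eqP; ring.
pose g (x : F) := (x ^+ Q - x)%R.
have img : #|g @: [set: F]| <= Q.
  have := @card_zeros_qpoly F Q 0%R 1%R 1%R 0%R Q1; rewrite oner_eq0 eqxx.
  rewrite addn0; move/(_ isT); apply: leq_trans; apply: subset_leq_card.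
  by apply/subsetP => _ /imsetP[x _ ->]; rewrite inE /g frobB frobK; apply/eqP; ring.
rewrite -(leq_pmul2l Q0) mulnn -cardF -cardsT -sum1_card.
rewrite (partition_big_imset g) /=; apply: leq_trans (leq_mul img (leqnn _)).
rewrite -sum_nat_const; apply: leq_sum => y /imsetP[x0 _ ->].
rewrite sum1dep_card -(card_imset _ (addIr (- x0)%R)).
apply: subset_leq_card; apply/subsetP => _ /imsetP[x xg ->].
move: xg; rewrite !inE /g frobB => /eqP; rewrite -subr_eq0 => xg.
move: xg; move: (x ^+ Q)%R (x0 ^+ Q)%R => y1 y2 /eqP.
by rewrite -subr_eq0; congr (_ == _); ring.
Qed.

(** The elliptic quadric, with the affine part identified with the quadratic
    extension K of the field T with Q elements: the word of (a, b, c) takes the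
    value [a + Tr (b * x) + c * Norm x] at x in K and the value c at the point at
    infinity, where [Tr y = y + y ^+ Q] and [Norm x = x ^+ Q.+1]. The difference
    of two words is a polynomial in x as in [card_zeros_qpoly]; it has Q + 1
    zeros only if the coefficients c differ, and then the words also differ at
    infinity. *)
Lemma ovoid_code (p k : nat) : prime p -> 0 < k ->
  exists (W I T : finType) (w : W -> I -> T),
    [/\ #|W| = (p ^ k) ^ 4, #|I| = (p ^ k) ^ 2 + 1, #|T| = p ^ k &
     separated W I T w ((p ^ k) ^ 2 - p ^ k)].
Proof.
move=> p_pr k0; set Q := p ^ k.
have Q1 : 1 < Q by rewrite -(expn0 p) ltn_exp2l // prime_gt1.
have [K pK cardK'] := @pPrimePowerField p (k * 2) p_pr (leq_trans k0 (leq_pmulr k (ltn0Sn 1))).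
have cardK : #|K| = Q ^ 2 by rewrite cardK' expnM.
have frobD (x y : K) : ((x + y) ^+ Q = x ^+ Q + y ^+ Q)%R.
  apply: exprDn_pchar; rewrite (eq_pnat _ (pcharf_eq pK)).
  by rewrite pnatX pnat_id.
have frobK (x : K) : (x ^+ Q ^+ Q = x)%R by rewrite -exprM mulnn -cardK expf_card.
have frobB (x y : K) : ((x - y) ^+ Q = x ^+ Q - y ^+ Q)%R.
  by rewrite -[in RHS](subrK y x) [in RHS]frobD addrK.
pose T := {x : K | x ^+ Q == x}%R.
have cardT : #|{: T}| = Q.
  by rewrite card_sig -[RHS](card_frobenius_fixed K Q Q1 frobD cardK) cardsE.
have fixT (a : T) : (val a ^+ Q = val a)%R by apply/eqP; exact: (valP a).
pose ev (u : T * K * T) (x : K) : K :=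
  (val u.1.1 + u.1.2 * x + u.1.2 ^+ Q * x ^+ Q + val u.2 * x ^+ Q.+1)%R.
have evT u x : (ev u x ^+ Q == ev u x)%R.
  rewrite /ev !frobD !exprMn frobK !fixT [(x ^+ Q.+1)%R]exprS exprMn frobK.
  apply/eqP; ring.
pose w u (o : option K) : T := if o is Some x then exist _ (ev u x) (evT u x) else u.2.
exists (T * K * T)%type, (option K), T, w; split.
- by rewrite !card_prod cardT cardK; ring.
- by rewrite card_option cardK addn1.
- by [].
move=> u v uv.
have agree : #|[set o | w u o == w v o]| <= Q.+1.
  rewrite card_set_option /=.
  have nz : [|| (val u.1.1 - val v.1.1 != 0), (u.1.2 - v.1.2 != 0),
      ((u.1.2 - v.1.2) ^+ Q != 0) | (val u.2 - val v.2 != 0)]%R.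
    rewrite !subr_eq0; move: uv; rewrite expf_eq0 subr_eq0 [val u.2 == _]val_eqE val_eqE.
    case: u => [[a b] c]; case: v => [[a' b'] c'] /=.
    by rewrite !xpair_eqE; do !case: (_ == _); rewrite ?andbF ?orbT.
  pose zeros := [set x : K | (val u.1.1 - val v.1.1) + (u.1.2 - v.1.2) * x
    + (u.1.2 - v.1.2) ^+ Q * x ^+ Q + (val u.2 - val v.2) * x ^+ Q.+1 == 0]%R.
  have := card_zeros_qpoly K Q _ _ _ _ Q1 nz; rewrite -/zeros => zeros_le.
  have -> : [set x | w u (Some x) == w v (Some x)] = zeros.
    apply/setP => x; rewrite !inE -val_eqE /= -subr_eq0 /ev frobB /=.
    by congr (_ == _)%R; ring.
  apply: leq_trans (leq_add (leqnn _) zeros_le) _.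
  rewrite subr_eq0 [val u.2 == _]val_eqE addnCA -addn1 leq_add2l.
  by case: (_ == _).
have := cardsC [set o | w u o == w v o]; rewrite card_option cardK.
have -> : ~: [set o | w u o == w v o] = [set o | w u o != w v o].
  by apply/setP => o; rewrite !inE.
move=> total; rewrite leq_subLR -ltnS -total -addSn leq_add2r.
exact: agree.
Qed.

(** Each outer letter is replaced by an inner word, so that each outer
    difference creates at least d' inner ones. *)
Lemma concatenated_code (W I T W' I' T' : finType) (w : W -> I -> T)
    (w' : W' -> I' -> T') (d d' : nat) :
    #|T| <= #|W'| -> separated W I T w d -> separated W' I' T' w' d' ->
  exists w'' : W -> I * I' -> T', separated W _ T' w'' (d * d').
Proof.
move=> TW sep sep'.
pose phi (t : T) : W' := enum_val (widen_ord TW (enum_rank t)).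
have phi_inj : injective phi.
  by move=> s t /enum_val_inj/(congr1 val)/= /val_inj/enum_rank_inj.
exists (fun x p => w' (phi (w x p.1)) p.2) => x y xy.
rewrite (card_set_pair _ _ (fun i j => w' (phi (w x i)) j != w' (phi (w y i)) j)).
apply: leq_trans (leq_mul (sep x y xy) (leqnn d')) _.
rewrite -sum_nat_const big_mkcond /=; apply: leq_sum => i _.
by rewrite inE; case: ifP => // wi; apply: sep'; rewrite (inj_eq phi_inj).
Qed.

Lemma sum_truncate (P : nat -> bool) (n r : nat) :
  \sum_(k < n) P k <= \sum_(k < r) P k + (n - r).
Proof.
rewrite -!(big_mkord xpredT (fun k => P k : nat)).
have [rn|nr] := leqP r n; last first.
  by rewrite (big_cat_nat (leq0n n) (ltnW nr)) /= -addnA leq_addr.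
rewrite (big_cat_nat (leq0n r) rn) /= leq_add2l -[n - r]muln1 -sum_nat_const_nat.
by apply: leq_sum => k _; case: (P k).
Qed.

(** Words are padded with a fixed letter if r exceeds [#|I|] and punctured
    otherwise; puncturing loses at most the number of removed positions. *)
Lemma separated_max_code_size (W I T : finType) (w : W -> I -> T)
    (d d' r : nat) :
    0 < #|T| -> 0 < d' -> d' + (#|I| - r) <= d -> separated W I T w d ->
  #|W| <= max_code_size #|T| r d'.
Proof.
move=> T0 d'0 d'd sep.
pose letter x k : 'I_#|T| :=
  if insub k is Some i then enum_rank (w x (@enum_val I predT i)) else Ordinal T0.
pose c x : {ffun 'I_r -> 'I_#|T|} := [ffun k => letter x (val k)].
have dist x y : x != y -> d' <= hamming_dist (c x) (c y).
  move=> xy; rewrite -(leq_add2r (#|I| - r)); apply: leq_trans d'd _.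
  apply: leq_trans (sep _ _ xy) _.
  have := sum_truncate (fun k => letter x k != letter y k) #|I| r.
  congr (_ <= _ + _).
    rewrite -sum1dep_card [RHS]big_mkcond [RHS](reindex (@enum_val I predT)) /=; last first.
      by apply: onW_bij; apply: enum_val_bij.
    apply: eq_bigr => i _; rewrite /letter valK (inj_eq enum_rank_inj).
    by case: (_ != _).
  rewrite /hamming_dist -sum1dep_card [RHS]big_mkcond; apply: eq_bigr => k _.
  by rewrite !ffunE; case: (_ != _).
(* This is where d' > 0 enters. *)
have c_inj : injective c.
  move=> x y cxy; apply/eqP/negPn/negP => /dist.
  rewrite /hamming_dist cxy leqNgt => /negP; apply.
  rewrite (_ : [set _ | _] = set0) ?cards0 //.
  by apply/setP => k; rewrite !inE eqxx.
rewrite -cardsT -(card_imset _ c_inj).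
apply: (@leq_bigmax_cond _ (fun C => min_dist_ge C d') (fun C => #|C|)).
apply/forall_inP => _ /imsetP[x _ ->]; apply/forall_inP => _ /imsetP[y _ ->].
by apply/implyP => cxy; apply: dist; apply: contra_neq cxy => ->.
Qed.

Lemma max_code_size_lower (q m r s : nat) :
    prime_power q -> 0 < m -> 0 < s ->
    s + (r_of q m - r) <= ((q ^ m) ^ 2 - q ^ m) * q ^ m.-1 ->
  (q ^ m) ^ 4 <= max_code_size q r s.
Proof.
move=> [p [e [p_pr e0 qE]]] m0 s0 dist.
have q1 : 1 < q by rewrite qE -(expn0 p) ltn_exp2l // prime_gt1.
have q0 : 0 < q by exact: ltnW.
have [F _ cardF] := @pPrimePowerField p e p_pr e0.
have {}cardF : #|F| = q by rewrite cardF qE.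
have [W' [I' [w' [cardW' cardI' dist']]]] := simplex_code F m.
have em0 : 0 < e * m by rewrite muln_gt0 e0.
have [W [I [T [w [cardW cardI cardT sep]]]]] := ovoid_code p (e * m) p_pr em0.
rewrite expnM -qE in cardW cardI cardT sep; rewrite cardF in cardW' cardI' dist'.
have sep' : separated _ _ _ w' (q ^ m.-1).
  move=> x y xy; rewrite -(leq_pmul2l q0) dist' // -expnS prednK //.
have [|w'' sep''] := concatenated_code _ _ _ _ _ _ w w' _ _ _ sep sep'.
  by rewrite cardT cardW'.
rewrite -cardW -cardF; apply: separated_max_code_size sep'' => //.
  by rewrite cardF.
apply: leq_trans dist; rewrite leq_add2l leq_sub2r // card_prod cardI.
rewrite /r_of leq_divRL ?subn_gt0 // -mulnA cardI' //.
Qed.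

(** * Numerical comparison *)

Lemma least_set_ramsey (k r s N0 : nat) : set_ramsey_prop k r s N0 ->
  exists N, is_set_ramsey k r s N /\ N <= N0.
Proof.
move=> ramsey; have ex : exists N, `[< set_ramsey_prop k r s N >].
  by exists N0; apply/asboolP.
case: (ex_minnP ex) => N /asboolP ramseyN minN.
exists N; split; last by apply: minN; apply/asboolP.
by split=> // N' /asboolP; exact: minN.
Qed.

Lemma j_of_exact (q m : nat) : 0 < q -> j_of q m * (q - 1) = q ^ m - 1.
Proof.
by move=> q0; rewrite /j_of divnK // !subn1 predn_exp dvdn_mulr.
Qed.

Lemma r_ofE (q m : nat) : 1 < q -> r_of q m = ((q ^ m) ^ 2 + 1) * j_of q m.
Proof.
move=> q1; have q0 : 0 < q by exact: ltnW.
by rewrite /r_of -j_of_exact // mulnA mulnK // subn_gt0.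
Qed.

Lemma r_of_bounds (q m : nat) : 1 < q -> 0 < m -> m <= r_of q m <= (q ^ m) ^ 3.
Proof.
move=> q1 m0; have q0 : 0 < q by exact: ltnW.
have Q1 : 1 < q ^ m by rewrite -(expn0 q) ltn_exp2l.
have J0 : 0 < j_of q m.
  by move: (j_of_exact q m q0); case: (j_of q m) => // /esym/eqP; rewrite mul0n subn_eq0 leqNgt Q1.
apply/andP; split.
  rewrite r_ofE //; apply: leq_trans (leq_pmulr _ J0).
  apply: leq_trans (ltnW (ltn_expl m q1)) _; rewrite -mulnn.
  by apply: leq_trans (leq_addr _ _); rewrite leq_pmull // ltnW.
rewrite /r_of; apply: leq_trans (leq_div _ _) _.
move: Q1; set Q := q ^ m; clearbody Q; case: Q => // Q _.
rewrite subn1 /= [(_ ^ 3)%N]expnSr mulnDl mul1n mulnS addnC leq_add2r -mulnn.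
exact: leq_trans (leqnSn Q) (leq_pmulr _ _).
Qed.

Local Open Scope ring_scope.

Lemma natural_colour_equation (R : realFieldType) (q r j s : nat) :
    (0 < q)%N -> (0 < s)%N ->
    s%:R = (1 - 1 / q%:R) * (r%:R - j%:R) :> R ->
  (q * s = (q - 1) * (r - j))%N.
Proof.
move=> q0 s0 sE; have q0R : 0 < q%:R :> R by rewrite ltr0n.
have qs : q%:R * s%:R = (q%:R - 1) * (r%:R - j%:R) :> R.
  by rewrite sE; field; rewrite gt_eqF.
have jr : (j <= r)%N.
  rewrite -(ler_nat R) leNgt; apply/negP => rj.
  have : 0 < q%:R * s%:R :> R by rewrite mulr_gt0 // ltr0n.
  rewrite qs ltNge => /negP; apply; apply: mulr_ge0_le0; last by rewrite subr_le0 ltW.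
  by rewrite subr_ge0 ler1n.
by apply/eqP; rewrite -(eqr_nat R) !natrM !natrB // qs.
Qed.

(** With rho = [r_of q m], the right-hand side is the distance
    (1 - 1/q) (rho - [j_of q m]) of the concatenated code. For r >= rho the
    bound on j gives r - j <= rho - [j_of q m]. For r < rho, each of the rho - r
    punctured positions lowers the required distance s by (1 - 1/q) through r
    and by (1 - 1/q) / (q - 1) = 1/q through j, together by 1, which is what
    puncturing costs. *)
Lemma eta_distance (R : realType) (q m r j s : nat) :
    (1 < q)%N -> (0 < m)%N ->
    eta R q m (r%:Z - (r_of q m)%:Z) <= j%:R ->
    s%:R = (1 - 1 / q%:R) * (r%:R - j%:R) :> R ->
  (s + (r_of q m - r) <= ((q ^ m) ^ 2 - q ^ m) * q ^ m.-1)%N.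
Proof.
move=> q1 m0 etaj sE; have q0 : (0 < q)%N by exact: ltnW.
have q0R : 0 < q%:R :> R by rewrite ltr0n.
have t0 : 0 < q%:R - 1 :> R by rewrite subr_gt0 ltr1n.
have qs : q%:R * s%:R = (q%:R - 1) * (r%:R - j%:R) :> R.
  by rewrite sE; field; rewrite gt_eqF.
have QQ : (q ^ m <= (q ^ m) ^ 2)%N by rewrite -mulnn leq_pmull // expn_gt0 q0.
have JE : (j_of q m)%:R * (q%:R - 1) = (q ^ m)%:R - 1 :> R.
  have <- : (q - 1)%N%:R = q%:R - 1 :> R by rewrite natrB.
  by rewrite -natrM j_of_exact // natrB // expn_gt0 q0.
have rhoE : (r_of q m)%:R = ((q ^ m)%:R ^+ 2 + 1) * (j_of q m)%:R :> R.
  by rewrite r_ofE // natrM natrD natrX.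
have dE : q%:R * (((q ^ m) ^ 2 - q ^ m) * q ^ m.-1)%N%:R
    = (q%:R - 1) * ((r_of q m)%:R - (j_of q m)%:R) :> R.
  transitivity ((q ^ m)%:R ^+ 2 * ((q ^ m)%:R - 1) : R).
    rewrite natrM mulrCA -[X in _ * X]natrM -expnS prednK // natrB // natrX; ring.
  by rewrite rhoE -JE; ring.
rewrite -(ler_nat R) -(ler_pM2l q0R) dE natrD mulrDr qs.
move: etaj; rewrite /eta subr_ge0 lez_nat.
case: leqP => [rr|rr].
  rewrite (eqP rr) /= mulr0 addr0 => etaj.
  rewrite ler_pM2l //; move: etaj; rewrite rmorphB /=; clear; lra.
rewrite natrB; last exact: ltnW.
rewrite rmorphB /= => /(ler_wpM2l (ltW t0)).
rewrite mulrBr [(_ - 1) * (_ / _)]mulrC divfK ?gt_eqF //.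
clear; lra.
Qed.

Lemma powR_third (R : realType) (x : R) : 0 <= x ->
  (x `^ (1 / 3)) ^+ 3 = x /\ x `^ (4 / 3) = (x `^ (1 / 3)) ^+ 4.
Proof.
move=> x0; rewrite -!powR_mulrn ?powR_ge0 // -!powRrM; split.
  by rewrite (_ : 1 / 3 * 3%:R = 1); [rewrite powRr1 | field].
by congr (_ `^ _); field.
Qed.

Lemma cube_le (R : realFieldType) (a b : R) :
  0 <= a -> 0 <= b -> a ^+ 3 <= b ^+ 3 -> a <= b.
Proof. by move=> a0 b0; rewrite ler_pXn2r // nnegrE. Qed.

(** Here y is the cube root of the reference length, so [L * y] and [B * y] are
    of lower order than [y ^+ 3] and [j ^+ 2] is of lower order than r. *)
Lemma window_bounds (R : realFieldType) (L B C y r j : R) :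
    1 <= y -> 2 * L <= y -> 2 * C * B ^+ 2 <= y -> 0 <= C -> 0 <= j <= B * y ->
    `|r - y ^+ 3| <= L * y ->
  [/\ y ^+ 3 <= 2 * r, r <= 2 * y ^+ 3 & C * j ^+ 2 <= r].
Proof.
move=> y1 yL yC C0 /andP[j0 jB]; rewrite ler_norml => /andP[lo hi].
have y0 : 0 <= y by lra.
have Ly : 2 * (L * y) <= y ^+ 3.
  apply: (@le_trans _ _ (y ^+ 2)); first by rewrite mulrA expr2 ler_wpM2r.
  by rewrite [y ^+ 3]exprS ler_peMl // sqr_ge0.
have r2 : y ^+ 3 <= 2 * r by lra.
split=> //; first by lra.
have jj : j ^+ 2 <= (B * y) ^+ 2 by rewrite lerXn2r // nnegrE; lra.
have := ler_wpM2l C0 jj.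
have := ler_wpM2r (sqr_ge0 y) yC; rewrite -exprS exprMn => h1 h2.
lra.
Qed.

Lemma lower_constant (R : realFieldType) (y z Q : R) :
    0 <= y -> 0 <= z -> 0 <= Q ->
    z ^+ 3 <= 2 * y ^+ 3 -> y ^+ 3 <= Q ^+ 3 ->
  1 / 16 * z ^+ 4 <= Q ^+ 4.
Proof.
move=> y0 z0 Q0 zy yQ; have zQ : z <= 2 * Q.
  apply: cube_le => //; first by lra.
  have Q3 : 0 <= Q ^+ 3 by rewrite exprn_ge0.
  by rewrite exprMn; lra.
have : z ^+ 4 <= (2 * Q) ^+ 4 by rewrite lerXn2r // nnegrE; lra.
rewrite exprMn; lra.
Qed.

Lemma upper_constant (R : realFieldType) (B y z j k : R) :
    0 <= y -> 0 <= z -> 0 <= k -> 0 <= B -> j <= B * y -> y ^+ 3 <= 2 * z ^+ 3 ->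
  k * z ^+ 3 * j <= 2 * k * B * z ^+ 4.
Proof.
move=> y0 z0 k0 B0 jB yz; have z3 : 0 <= z ^+ 3 by rewrite exprn_ge0.
have yz2 : y <= 2 * z.
  by apply: cube_le => //; [lra | rewrite exprMn; lra].
have j2 : j <= B * (2 * z) by apply: le_trans jB _; rewrite ler_wpM2l.
have := ler_wpM2l (mulr_ge0 k0 z3) j2; congr (_ <= _); ring.
Qed.

Theorem corollary1p3 (R : realType) (q : nat) (L B : R)
  (hq : prime_power q) (hL : 0 < L)
  (hB : (q%:R - 1) `^ (- (2 / 3)) + L < B) :
  exists (c1 C1 c2 C2 : R) (M : nat),
    [/\ 0 < c1, 0 < C1, 0 < c2 & 0 < C2] /\
    forall m : nat, (M <= m)%N ->
    forall r j s : nat, (0 < r)%N -> (0 < j)%N -> (0 < s)%N ->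
      `|r%:R - (r_of q m)%:R| <= L * (r_of q m)%:R `^ (1 / 3) ->
      eta R q m (r%:Z - (r_of q m)%:Z) <= j%:R ->
      j%:R <= B * (r_of q m)%:R `^ (1 / 3) ->
      s%:R = (1 - 1 / q%:R) * (r%:R - j%:R) :> R ->
      (c1 * r%:R `^ (4 / 3) <= (max_code_size q r s)%:R
         <= C1 * r%:R `^ (4 / 3)) /\
      exists N : nat,
        is_set_ramsey q.+1 r s N /\
        c2 * r%:R `^ (4 / 3) <= N%:R <= C2 * r%:R `^ (4 / 3).
Proof.
have q1 : (1 < q)%N.
  case: hq => p [e [p_pr e0 ->]].
  by rewrite -(expn0 p) ltn_exp2l // prime_gt1.
have B0 : 0 < B by apply: lt_trans hB; rewrite ltr_wpDl // powR_ge0.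
pose K : R := (4356 * q ^ 7)%N%:R; pose k : R := (1057 * q ^ 4)%N%:R.
(* Above Y, the cube root of the reference length satisfies the hypotheses of
   [window_bounds]. *)
pose Y : R := 1 + 2 * L + 2 * K * B ^+ 2.
have K0 : 0 <= K by exact: ler0n.
have k0 : 0 < k by rewrite ltr0n muln_gt0 expn_gt0 (ltnW q1).
have KB : 0 <= 2 * K * B ^+ 2 by rewrite !mulr_ge0 // ltW.
have [Y0 Y1 YL YK] : [/\ 0 <= Y, 1 <= Y, 2 * L <= Y & 2 * K * B ^+ 2 <= Y].
  by rewrite /Y; move: KB; clear -hL; move: (2 * K * _) => x x0; split; lra.
have C0 : 0 < 2 * k * B by rewrite !mulr_gt0.
exists (1 / 16), (2 * k * B), (1 / 16), (2 * k * B), (Num.bound (Y ^+ 3)).+1.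
split; first by split=> //; lra.
move=> m Mm r j s r0 j0 s0 hr heta hj hs.
have m0 : (0 < m)%N by exact: leq_trans Mm.
have /andP[m_rho rho_Q] := r_of_bounds q m q1 m0.
have [y3 _] := powR_third R (r_of q m)%:R (ler0n _ _).
have [z3 ->] := powR_third R r%:R (ler0n _ _).
have y0 : 0 <= (r_of q m)%:R `^ (1 / 3) :> R by exact: powR_ge0.
have z0 : 0 <= r%:R `^ (1 / 3) :> R by exact: powR_ge0.
move: hr hj y3 z3 y0 z0; set y := (r_of q m)%:R `^ _; set z := r%:R `^ _.
clearbody y z => hr hj y3 z3 y0 z0.
have Yy : Y <= y.
  apply: cube_le => //; rewrite y3.
  have := archi_boundP (exprn_ge0 3 Y0) => /ltW; move/le_trans; apply.
  by rewrite ler_nat; apply: leq_trans m_rho; exact: ltnW.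
rewrite -y3 in hr.
have j0R : 0 <= j%:R :> R by [].
have [||||yr ry Kj] := @window_bounds R L B K y r%:R j%:R _ _ _ K0 _ hr.
- exact: le_trans Yy.
- exact: le_trans Yy.
- exact: le_trans Yy.
- by rewrite j0R.
have sE := natural_colour_equation R q r j s (ltnW q1) s0 hs.
have small : (4356 * q ^ 7 * j ^ 2 <= r)%N.
  by rewrite -(ler_nat R) natrM [in X in _ * X]natrX.
have ramsey := set_ramsey_upper q r j s _ q1 j0 sE small (ltnSn _).
have [N [isN NN0]] := least_set_ramsey _ _ _ _ ramsey.
have code_lt := max_code_size_lt_ramsey _ _ _ _ isN.1.
have code_ge := max_code_size_lower q m r s hq m0 s0
  (eta_distance R q m r j s q1 m0 heta hs).
have low : 1 / 16 * z ^+ 4 <= ((q ^ m) ^ 4)%N%:R.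
  rewrite natrX; apply: (@lower_constant _ y) => //; first by rewrite z3.
  by rewrite y3 -natrX ler_nat.
have up : N%:R <= 2 * k * B * z ^+ 4.
  apply: le_trans (_ : k * z ^+ 3 * j%:R <= _); last first.
    by apply: (@upper_constant _ _ y); rewrite ?z3 // ltW.
  rewrite z3 /k -!natrM ler_nat; apply: leq_trans NN0 _.
  have : (0 < q ^ 4 * r * j)%N by rewrite !muln_gt0 ?expn_gt0 (ltnW q1) r0 j0.
  have E c : (c * q ^ 4 * r * j = c * (q ^ 4 * r * j))%N by rewrite !mulnA.
  rewrite !E; move: (q ^ 4 * r * j)%N; clear; lia.
split; last (exists N; split; first exact: isN); apply/andP; split=> //.
- by apply: le_trans low _; rewrite ler_nat.
- by apply: le_trans up; rewrite ler_nat ltnW.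
- by apply: le_trans low _; rewrite ler_nat (leq_trans code_ge) // ltnW.
Qed.
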